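(* The rotated SDP relaxation is equivalent to the original SDP relaxation.
   Context: Notation: $(\cdot)^H$ is conjugate transpose; $\boldsymbol A\bullet\boldsymbol B=\mathrm{tr}(\boldsymbol A\boldsymbol B)$; $\boldsymbol A\succeq \boldsymbol 0$ means Hermitian positive semidefinite. Data: integers $N_t,M\ge1$, $L,P\ge0$; nonzero channel vectors $\boldsymbol h_m\in\mathbb C^{N_t}$, SINR targets $\gamma_m>0$ and noise variances $\sigma_m^2>0$, $m=1,\dots,M$. For $i,j\in\{1,\dots,M\}$ put $\boldsymbol A_{ii}=\frac1{\gamma_i}\boldsymbol h_i\boldsymbol h_i^H$, $\boldsymbol A_{ij}=-\boldsymbol h_i\boldsymbol h_i^H$ if $j\ne i$, $\tau_i=\sigma_i^2$, and let $\unrhd_i$ be $\ge$. For $i=M+1,\dots,M+L$ and $j=1,\dots,M$, $\boldsymbol A_{ij}\in\mathbb C^{N_t\times N_t}$ are arbitrary Hermitian matrices, $\tau_i\in\mathbb R$ and $\unrhd_i\in\{\le,=,\ge\}$. For $p=1,\dots,P$, $m=1,\dots,M$, $\boldsymbol C_{pm}\in\mathbb C^{N_t\times N_t}$ are arbitrary Hermitian matrices and $\ell_{pm}\le0\le\mu_{pm}$ are prescribed bounds. Let $\bar{\boldsymbol h}_m=\boldsymbol h_m/\|\boldsymbol h_m\|$, let the columns of $\boldsymbol F_m\in\mathbb C^{N_t\times(N_t-1)}$ be an orthonormal basis of the orthogonal complement of $\boldsymbol h_m$, and let $\boldsymbol U_m=[\bar{\boldsymbol h}_m\ \boldsymbol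 F_m]$ (a unitary matrix). Original SDP relaxation: minimize $\sum_{m=1}^M\mathrm{tr}(\boldsymbol X_m)$ over Hermitian $\boldsymbol X_1,\dots,\boldsymbol X_M\in\mathbb C^{N_t\times N_t}$ subject to $\sum_{j=1}^M\boldsymbol A_{ij}\bullet\boldsymbol X_j\unrhd_i\tau_i$ ($i=1,\dots,M+L$), $\ell_{pm}\le\boldsymbol C_{pm}\bullet\boldsymbol X_m\le\mu_{pm}$ (all $p,m$), $\boldsymbol X_m\succeq\boldsymbol 0$ (all $m$). Rotated SDP relaxation: minimize $\sum_{m=1}^M\mathrm{tr}(\boldsymbol U_m\bar{\boldsymbol X}_m\boldsymbol U_m^H)$ over Hermitian $\bar{\boldsymbol X}_m=\begin{bmatrix}\eta_m&\boldsymbol\xi_m^H\\ \boldsymbol\xi_m&\boldsymbol\Gamma_m\end{bmatrix}\in\mathbb C^{N_t\times N_t}$ ($\eta_m$ scalar), $m=1,\dots,M$, subject to $\sum_{j=1}^M\boldsymbol A_{ij}\bullet\boldsymbol U_j\bar{\boldsymbol X}_j\boldsymbol U_j^H\unrhd_i\tau_i$ ($i=1,\dots,M+L$), $\ell_{pm}\le\boldsymbol C_{pm}\bullet\boldsymbol U_m\bar{\boldsymbol X}_m\boldsymbol U_m^H\le\mu_{pm}$ (all $p,m$), $\bar{\boldsymbol X}_m\succeq\boldsymbol 0$ (all $m$). *)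

(* Defs.v *)
(* The complex numbers are R[i] over R : realType. The dimension N_t >= 1 is
   written 1 + n, so that matrices carry the block structure (1, N_t - 1). *)
From HB Require Import structures.
From mathcomp Require Import all_boot all_order all_algebra.
From mathcomp Require Import spectral sesquilinear.
From mathcomp Require Import classical_sets functions reals constructive_ereal.
From mathcomp Require Import ereal.
From mathcomp Require Import complex.

Set Implicit Arguments.
Unset Strict Implicit.
Unset Printing Implicit Defensive.
Import Order.TTheory GRing.Theory Num.Theory.
Local Open Scope ring_scope.
Local Open Scope classical_set_scope.
Local Open Scope sesquilinear_scope.
Local Open Scope complex_scope.

Record program (R : realType) (V : Type) := Program {
  feasible : set V;
  objective : V -> R }.

(* The infimum is extended-real: +oo for an infeasible program. *)
Definition optimal_value (R : realType) (V : Type) (p : program R V) : \bar R :=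
  ereal_inf [set (objective p x)%:E | x in feasible p].

Definition optimal_solutions (R : realType) (V : Type) (p : program R V) :
    set V :=
  [set x | feasible p x /\
     forall y, feasible p y -> objective p x <= objective p y].

(* A \bullet X = tr (A X) *)
Definition bullet (R : realType) (k : nat) (A X : 'M[R[i]]_k) : R[i] :=
  \tr (A *m X).

Definition psd (R : realType) (k : nat) (X : 'M[R[i]]_k) : Prop :=
  X \is hermsymmx /\ forall v : 'cV[R[i]]_k, 0 <= (v^t* *m X *m v) 0 0.

(* Euclidean norm; the library's norm on matrices is the sup norm. *)
Definition cvnorm (R : realType) (k : nat) (v : 'cV[R[i]]_k) : R[i] :=
  sqrtC ((v^t* *m v) 0 0).

Variant sense := SLe | SEq | SGe.

(* The order of R[i] is partial: x <= y means that y - x is real and >= 0. On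
   Hermitian matrices both sides of every constraint below are real. *)
Definition rel_of (R : realType) (s : sense) (x y : R[i]) : Prop :=
  match s with
  | SLe => x <= y
  | SEq => x = y
  | SGe => y <= x
  end.

(* A0, tau0 and sense0 describe the constraints of index M+1, ..., M+L. *)
Record sdp_data (R : realType) (n M L P : nat) := SdpData {
  chan : 'I_M -> 'cV[R[i]]_(1 + n);
  sinr : 'I_M -> R;
  sigma2 : 'I_M -> R;
  A0 : 'I_L -> 'I_M -> 'M[R[i]]_(1 + n);
  tau0 : 'I_L -> R;
  sense0 : 'I_L -> sense;
  Cmx : 'I_P -> 'I_M -> 'M[R[i]]_(1 + n);
  ell : 'I_P -> 'I_M -> R;
  mu : 'I_P -> 'I_M -> R }.

Section Sdp.
Variables (R : realType) (n M L P : nat) (D : sdp_data R n M L P).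
Local Notation C := R[i].

Definition Amx (i : 'I_(M + L)) (j : 'I_M) : 'M[C]_(1 + n) :=
  match fintype.split i with
  | inl k => let hh := chan D k *m (chan D k)^t* in
             if j == k then ((sinr D k)^-1)%:C *: hh else - hh
  | inr l => A0 D l j
  end.

Definition tau (i : 'I_(M + L)) : R :=
  match fintype.split i with inl k => sigma2 D k | inr l => tau0 D l end.

Definition csense (i : 'I_(M + L)) : sense :=
  match fintype.split i with inl _ => SGe | inr l => sense0 D l end.

(* On feasible points the sum of traces is real, so Re discards nothing. *)
Definition original_sdp : program R ('I_M -> 'M[C]_(1 + n)) := {|
  feasible := [set X |
    [/\ forall m, X m \is hermsymmx,
        forall i, rel_of (csense i) (\sum_j bullet (Amx i j) (X j)) (tau i)%:C,
        forall p m, (ell D p m)%:C <= bullet (Cmx D p m) (X m)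
                                      <= (mu D p m)%:C
      & forall m, psd (X m)]];
  objective := fun X => complex.Re (\sum_m \tr (X m)) |}.

(* The columns of F form an orthonormal basis of the orthogonal complement
   of h. *)
Definition onb_orthocompl (h : 'cV[C]_(1 + n)) (F : 'M[C]_(1 + n, n)) : Prop :=
  F^t* *m F = 1%:M /\
  forall x : 'cV[C]_(1 + n), h^t* *m x = 0 <-> exists c : 'cV[C]_n, x = F *m c.

Variable F : 'I_M -> 'M[C]_(1 + n, n).

Definition hbar (m : 'I_M) : 'cV[C]_(1 + n) :=
  (cvnorm (chan D m))^-1 *: chan D m.

Definition Umx (m : 'I_M) : 'M[C]_(1 + n) := row_mx (hbar m) (F m).

Definition rotate (Xb : 'I_M -> 'M[C]_(1 + n)) : 'I_M -> 'M[C]_(1 + n) :=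
  fun m => Umx m *m Xb m *m (Umx m)^t*.

Definition rotated_sdp : program R ('I_M -> 'M[C]_(1 + n)) := {|
  feasible := [set Xb |
    [/\ forall m, Xb m \is hermsymmx /\
          exists (eta : C) (xi : 'cV[C]_n) (Gamma : 'M[C]_n),
            Xb m = block_mx eta%:M (xi^t*) xi Gamma,
        forall i, rel_of (csense i)
          (\sum_j bullet (Amx i j) (Umx j *m Xb j *m (Umx j)^t*)) (tau i)%:C,
        forall p m, (ell D p m)%:C
          <= bullet (Cmx D p m) (Umx m *m Xb m *m (Umx m)^t*)
          <= (mu D p m)%:C
      & forall m, psd (Xb m)]];
  objective := fun Xb =>
    complex.Re (\sum_m \tr (Umx m *m Xb m *m (Umx m)^t*)) |}.

End Sdp.

(* Main.v *)
Require Import Defs.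
From HB Require Import structures.
From mathcomp Require Import all_boot all_order all_algebra.
From mathcomp Require Import spectral sesquilinear.
From mathcomp Require Import boolp classical_sets functions reals constructive_ereal.
From mathcomp Require Import ereal.
From mathcomp Require Import complex.
Import Order.TTheory GRing.Theory Num.Theory.
Local Open Scope ring_scope.
Local Open Scope classical_set_scope.

Set Implicit Arguments.
Unset Strict Implicit.
Local Open Scope sesquilinear_scope.

(** Each [Umx D F m] is unitary: its first column is the normalised channel, and the others form an
    orthonormal basis of the complement of that channel. Hence the congruence X -> U X U^H is undone
    by X -> U^H X U, and both directions preserve Hermitian symmetry and semidefiniteness. The
    rotated constraints and objective are the original ones evaluated at [rotate D F Xb], and the
    prescribed block shape holds for every Hermitian matrix. So [rotate] is an objective-preserving
    bijection of the feasible sets ([rotate_bij]), and such a bijection transfers optimal values and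
    minimizers. *)

(** Both infima are taken over the same set of attained values, which is empty for both programs if
    either is infeasible. *)
Lemma bij_optimal_value (R : realType) (V W : Type) (p : program R V)
    (q : program R W) (f : V -> W) :
  set_bij (feasible p) (feasible q) f ->
  (forall x, feasible p x -> objective q (f x) = objective p x) ->
  optimal_value p = optimal_value q.
Proof.
move=> [ffun _ fsurj] fobj; congr ereal_inf; apply/seteqP; split => _ [x px <-].
  by exists (f x); [exact: ffun|rewrite fobj].
by have [y py <-] := fsurj _ px; exists y => //; rewrite fobj.
Qed.

(** Surjectivity pulls every competitor in [q] back to one in [p], so minimality transfers in both
    directions. *)
Lemma bij_optimal_solutions (R : realType) (V W : Type) (p : program R V)
    (q : program R W) (f : V -> W) :
  set_bij (feasible p) (feasible q) f ->
  (forall x, feasible p x -> objective q (f x) = objective p x) ->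
  set_bij (optimal_solutions p) (optimal_solutions q) f.
Proof.
move=> [ffun finj fsurj] fobj; split.
- move=> x [px xmin]; split; first exact: ffun.
  by move=> _ /fsurj[y py <-]; rewrite !fobj//; exact: xmin.
- move=> x y /set_mem[px _] /set_mem[py _].
  by apply: finj; exact: mem_set.
- move=> _ [/fsurj[x px <-] xmin]; exists x => //; split => // y py.
  by rewrite -!fobj//; apply: xmin; exact: ffun.
Qed.

Lemma trmxC_mul (C : numClosedFieldType) (m n p : nat) (A : 'M[C]_(m, n))
    (B : 'M[C]_(n, p)) : (A *m B)^t* = B^t* *m A^t*.
Proof. by rewrite trmx_mul map_mxM. Qed.

Lemma trmxC_scale (C : numClosedFieldType) (m n : nat) (a : C)
    (A : 'M[C]_(m, n)) : (a *: A)^t* = a^* *: A^t*.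
Proof. by rewrite linearZ map_mxZ. Qed.

Lemma hermsymmxP (C : numClosedFieldType) (n : nat) (A : 'M[C]_n) :
  reflect (A = A^t*) (A \is hermsymmx).
Proof. by rewrite is_hermitianmxE expr0 scale1r; exact: eqP. Qed.

Lemma hermsymmx_congr (C : numClosedFieldType) (m n : nat) (U : 'M[C]_(m, n))
    (X : 'M[C]_n) : X \is hermsymmx -> U *m X *m U^t* \is hermsymmx.
Proof.
move=> /hermsymmxP hX; apply/hermsymmxP.
by rewrite !trmxC_mul trmxCK -hX mulmxA.
Qed.

(** The quadratic form of U X U^H at v is that of X at U^H v. *)
Lemma psd_congr (R : realType) (m n : nat) (U : 'M[R[i]]_(m, n))
    (X : 'M[R[i]]_n) : psd X -> psd (U *m X *m U^t*).
Proof.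
move=> [hX X0]; split; first exact: hermsymmx_congr.
move=> v; have := X0 (U^t* *m v).
by rewrite trmxC_mul trmxCK !mulmxA.
Qed.

(** Makes the block-shape clause of the rotated program automatic: symmetry ties the two
    off-diagonal blocks, and the corner is 1 by 1. *)
Lemma hermsymmx_block (C : numClosedFieldType) (n : nat) (X : 'M[C]_(1 + n)) :
  X \is hermsymmx ->
  exists (eta : C) (xi : 'cV[C]_n) (Gamma : 'M[C]_n),
    X = block_mx eta%:M (xi^t*) xi Gamma.
Proof.
move=> /hermsymmxP hX.
exists (ulsubmx X 0 0), (dlsubmx X), (drsubmx X).
rewrite -mx11_scalar -[LHS]submxK; congr block_mx.
by rewrite trmx_dlsub map_ursubmx -hX.
Qed.

Lemma cvnorm_gt0 (R : realType) (k : nat) (v : 'cV[R[i]]_k) :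
  v != 0 -> 0 < cvnorm v.
Proof.
move=> v0; rewrite /cvnorm sqrtC_gt0.
have vvE : (v^t* *m v) 0 0 = \sum_j v j 0 * (v j 0)^*.
  by rewrite mxE; apply: eq_bigr => j _; rewrite !mxE mulrC.
rewrite vvE lt_def sumr_ge0 ?andbT; last by move=> j _; exact: mul_conjC_ge0.
apply: contra v0 => /eqP vv0; apply/eqP/matrixP => i j.
rewrite ord1 mxE; apply/eqP; rewrite -mul_conjC_eq0; apply/eqP.
by apply: (psumr_eq0P _ vv0) => // k0 _; exact: mul_conjC_ge0.
Qed.

Lemma onb_orthocompl_orthogonal (R : realType) (n : nat)
    (h : 'cV[R[i]]_(1 + n)) (F : 'M[R[i]]_(1 + n, n)) :
  onb_orthocompl h F -> h^t* *m F = 0.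
Proof.
move=> [_ Fh]; apply/matrixP => i j.
(* Column j of F is F e_j, which lies in the range of F. *)
have /matrixP/(_ i 0) : h^t* *m (F *m delta_mx j 0 : 'cV_(1 + n)) = 0.
  by apply/Fh; exists (delta_mx j 0).
by rewrite mulmxA -colE !mxE.
Qed.

Section Rotation.
Variables (R : realType) (n M L P : nat) (D : sdp_data R n M L P).
Variable F : 'I_M -> 'M[R[i]]_(1 + n, n).
Hypothesis chan_neq0 : forall m, chan D m != 0.
Hypothesis F_onb : forall m, onb_orthocompl (chan D m) (F m).
Local Notation U := (Umx D F).

Lemma hbar_unit m : (hbar D m)^t* *m hbar D m = 1%:M.
Proof.
have c0 := cvnorm_gt0 (chan_neq0 m).
rewrite /hbar trmxC_scale -scalemxAl -scalemxAr scalerA.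
rewrite [_ *m _]mx11_scalar scale_scalar_mx; congr _%:M.
(* Writes h^H h as the square of the norm, which cancels the two inverse norms; these are real, so
   conjugation fixes them. *)
rewrite -[X in _ * X]sqrtCK -/(cvnorm _) geC0_conj ?invr_ge0 ?ltW//.
by rewrite expr2 mulrACA mulVf ?mulr1// gt_eqF.
Qed.

(** Computed blockwise: the diagonal blocks are identities by normalisation, the off-diagonal ones
    vanish by orthogonality. *)
Lemma Umx_trmxCK m : (U m)^t* *m U m = 1%:M.
Proof.
have hF : (hbar D m)^t* *m F m = 0.
  rewrite /hbar trmxC_scale -scalemxAl.
  by rewrite onb_orthocompl_orthogonal ?scaler0.
have Fh : (F m)^t* *m hbar D m = 0.
  by rewrite -[LHS]trmxCK trmxC_mul trmxCK hF trmx0 map_mx0.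
rewrite /Umx tr_row_mx map_col_mx mul_col_row hbar_unit hF Fh.
by rewrite (F_onb m).1 -scalar_mx_block.
Qed.

Lemma Umx_trmxKC m : U m *m (U m)^t* = 1%:M.
Proof. by apply: mulmx1C; exact: Umx_trmxCK. Qed.

(* The double conjugate transpose gives the map the form V X V^H, to which the
   congruence lemmas apply. *)
Definition unrotate (X : 'I_M -> 'M[R[i]]_(1 + n)) : 'I_M -> 'M[R[i]]_(1 + n) :=
  fun m => (U m)^t* *m X m *m (U m)^t*^t*.

Lemma rotateK : cancel (rotate D F) unrotate.
Proof.
move=> X; apply/funext => m; rewrite /unrotate /rotate trmxCK !mulmxA.
by rewrite Umx_trmxCK mul1mx -mulmxA Umx_trmxCK mulmx1.
Qed.

Lemma unrotateK : cancel unrotate (rotate D F).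
Proof.
move=> X; apply/funext => m; rewrite /unrotate /rotate trmxCK !mulmxA.
by rewrite Umx_trmxKC mul1mx -mulmxA Umx_trmxKC mulmx1.
Qed.

(** The linear constraints and bounds agree by conversion, leaving only symmetry and
    semidefiniteness. For the converse, [Xb] is recovered as a congruence of its rotation by U^H. *)
Lemma rotate_feasible Xb :
  feasible (rotated_sdp D F) Xb <-> feasible (original_sdp D) (rotate D F Xb).
Proof.
split=> [[hX cA cC X0]|[hX cA cC X0]]; split=> // m.
- by apply: hermsymmx_congr; case: (hX m).
- exact: psd_congr.
- have hXb : Xb m \is hermsymmx.
    by rewrite -(rotateK Xb); apply: hermsymmx_congr.
  by split=> //; exact: hermsymmx_block.
- by rewrite -(rotateK Xb); apply: psd_congr.
Qed.

Lemma rotate_bij :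
  set_bij (feasible (rotated_sdp D F)) (feasible (original_sdp D))
    (rotate D F).
Proof.
split.
- by move=> Xb /rotate_feasible.
- by move=> X Y _ _; exact: (can_inj rotateK).
- move=> X hX; exists (unrotate X); last exact: unrotateK.
  by apply/rotate_feasible; rewrite unrotateK.
Qed.

End Rotation.

Unset Implicit Arguments.
Set Strict Implicit.
Local Close Scope sesquilinear_scope.

Theorem lemma1 (R : realType) (n M L P : nat) (D : sdp_data R n M L P)
    (F : 'I_M -> 'M[R[i]]_(1 + n, n))
    (hM : (0 < M)%N)
    (hchan : forall m, chan D m != 0)
    (hsinr : forall m, 0 < sinr D m)
    (hsigma2 : forall m, 0 < sigma2 D m)
    (hA0 : forall l j, A0 D l j \is hermsymmx)
    (hC : forall p m, Cmx D p m \is hermsymmx)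
    (hbounds : forall p m, ell D p m <= 0 <= mu D p m)
    (hF : forall m, onb_orthocompl (chan D m) (F m)) :
  [/\ set_bij (feasible (rotated_sdp D F)) (feasible (original_sdp D))
        (rotate D F),
      forall Xb, feasible (rotated_sdp D F) Xb ->
        objective (original_sdp D) (rotate D F Xb) =
        objective (rotated_sdp D F) Xb,
      optimal_value (rotated_sdp D F) = optimal_value (original_sdp D) &
      set_bij (optimal_solutions (rotated_sdp D F))
        (optimal_solutions (original_sdp D)) (rotate D F)].
Proof.
have rbij := rotate_bij hchan hF.
by split=> //; [exact: bij_optimal_value rbij _|
                exact: bij_optimal_solutions rbij _].
Qed.
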